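(* Let $G(s)$ be a SISO (scalar) proper real rational transfer function. Then $G(s)$ is negative imaginary if and only if $G(s)$ is analytic in $\{s\in\mathbb{C}:\mathrm{Re}[s]>0\}$ and the inequality $$ j\,(G(\sigma)-G(\sigma)^* )\ \ge\ 0 $$ holds for every $\sigma=j\omega+\epsilon$ with $\omega\ge 0$, $\epsilon\ge 0$ that is not a pole of $G(s)$.
   Context: Here $j=\sqrt{-1}$ and $^*$ denotes the complex conjugate transpose (for scalars, the complex conjugate). Definition (negative imaginary, NI). A square real rational transfer function matrix $G(s)$ is negative imaginary (NI) if: (1) $G(s)$ has no pole in $\mathrm{Re}[s]>0$; (2) for all $\omega\ge 0$ such that $j\omega$ is not a pole of $G(s)$, $j(G(j\omega)-G(j\omega)^* )\ge 0$ (Hermitian positive semidefinite); (3) if $s=j\omega_0$ with $\omega_0>0$ is a pole of $G(s)$, then it is a simple pole and the matrix $K_0=\lim_{s\to j\omega_0}(s-j\omega_0)\,jG(s)$ is Hermitian positive semidefinite; (4) if $s=0$ is a pole of $G(s)$, then it is either a simple pole or a double pole, and if it is a double pole then $\lim_{s\to 0}s^2G(s)\ge 0$. *)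

(* Defs.v *)
From HB Require Import structures.
From mathcomp Require Import all_boot all_order all_algebra.
From mathcomp Require Import generic_quotient.
From mathcomp Require Import sesquilinear spectral.
From mathcomp Require Import complex.
From mathcomp Require Import all_classical all_reals all_analysis.

Set Implicit Arguments.
Unset Strict Implicit.
Unset Printing Implicit Defensive.

Import Order.TTheory GRing.Theory Num.Theory.
Import numFieldNormedType.Exports.

Local Open Scope classical_set_scope.
Local Open Scope ring_scope.
Local Open Scope sesquilinear_scope.
Local Open Scope quotient_scope.

(* The topology of R[i] is the one induced by its modulus. *)
HB.instance Definition _ (R : realType) := PseudoPointedMetric.copy R[i] R[i]^o.

(* Real rational functions are elements of the field {fraction {poly R}}. The
   library's chosen representative of a fraction need not be in lowest terms,
   hence the division by the gcd. *)
Definition rf_num (R : realType) (g : {fraction {poly R}}) : {poly R} :=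
  (frac (repr g)).1 %/ gcdp (frac (repr g)).1 (frac (repr g)).2.

Definition rf_den (R : realType) (g : {fraction {poly R}}) : {poly R} :=
  (frac (repr g)).2 %/ gcdp (frac (repr g)).1 (frac (repr g)).2.

Lemma rf_den_neq0 (R : realType) (g : {fraction {poly R}}) : rf_den g != 0.
Proof.
rewrite /rf_den dvdp_div_eq0 ?dvdp_gcdr //; exact: denom_ratioP.
Qed.

Lemma rf_coprime (R : realType) (g : {fraction {poly R}}) :
  coprimep (rf_num g) (rf_den g).
Proof.
by apply: coprimep_div_gcd; rewrite denom_ratioP orbT.
Qed.

Lemma rf_numdenE (R : realType) (g : {fraction {poly R}}) :
  g = FracField.tofrac (rf_num g) / FracField.tofrac (rf_den g).
Proof.
set n := (frac (repr g)).1; set d := (frac (repr g)).2.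
have d0 : d != 0 by exact: denom_ratioP.
have tF (x : {poly R}) : FracField.tofrac x = \pi_({fraction {poly R}}) (Ratio x 1).
  by unlock FracField.tofrac.
have gE : g * FracField.tofrac d = FracField.tofrac n.
  rewrite -[g in LHS]reprK !tF.
  transitivity (\pi_({fraction {poly R}}) (FracField.mulf (repr g) (Ratio d 1))).
    by rewrite FracField.pi_mul.
  apply/eqmodP; rewrite /= FracField.equivfE /FracField.mulf.
  by rewrite !numden_Ratio ?mulf_neq0 ?oner_neq0 // !mulr1 mulrC.
have c0 : gcdp n d != 0 by rewrite gcdp_eq0 negb_and d0 orbT.
have q0 := rf_den_neq0 g.
apply: (@mulIf _ (FracField.tofrac (rf_den g))); first by rewrite tofrac_eq0.
rewrite mulfVK ?tofrac_eq0 //.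
apply: (@mulIf _ (FracField.tofrac (gcdp n d))); first by rewrite tofrac_eq0.
by rewrite -mulrA -!tofracM /rf_num /rf_den !divpK ?dvdp_gcdl ?dvdp_gcdr.
Qed.

Definition complex_poly (R : realType) (p : {poly R}) : {poly R[i]} :=
  map_poly (real_complex R) p.

(* Equal to 0 at the poles, since _ / 0 = 0 *)
Definition rf_eval (R : realType) (g : {fraction {poly R}}) (s : R[i]) : R[i] :=
  (complex_poly (rf_num g)).[s] / (complex_poly (rf_den g)).[s].

Definition rf_proper (R : realType) (g : {fraction {poly R}}) : Prop :=
  (size (rf_num g) <= size (rf_den g))%N.

(* Nonzero exactly at the poles: the fraction is in lowest terms. *)
Definition pole_order (R : realType) (g : {fraction {poly R}}) (s : R[i]) : nat :=
  mup s (complex_poly (rf_den g)).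

Definition is_pole (R : realType) (g : {fraction {poly R}}) (s : R[i]) : Prop :=
  (0 < pole_order g s)%N.

Definition mx_eval (R : realType) (m : nat) (G : 'M[{fraction {poly R}}]_m)
    (s : R[i]) : 'M[R[i]]_m :=
  \matrix_(i, j) rf_eval (G i j) s.

(* The poles of a matrix are those of its entries; the order is the largest one
   among the entries, so mx_pole_order G s = 1 is a simple pole. *)
Definition mx_pole_order (R : realType) (m : nat)
    (G : 'M[{fraction {poly R}}]_m) (s : R[i]) : nat :=
  \max_(i < m) \max_(j < m) pole_order (G i j) s.

Definition is_mx_pole (R : realType) (m : nat)
    (G : 'M[{fraction {poly R}}]_m) (s : R[i]) : Prop :=
  (0 < mx_pole_order G s)%N.

(* For z : R[i], 0 <= z means that z is real and nonnegative. *)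
Definition psd (R : realType) (m : nat) (M : 'M[R[i]]_m) : Prop :=
  M \is hermsymmx /\ forall v : 'cV[R[i]]_m, 0 <= (v^t* *m M *m v) 0 0.

Definition negative_imaginary (R : realType) (m : nat)
    (G : 'M[{fraction {poly R}}]_m) : Prop :=
  [/\ forall s : R[i], 0 < complex.Re s -> ~ is_mx_pole G s,
      forall w : R, 0 <= w -> ~ is_mx_pole G (0 +i* w)%C ->
        psd ('i *: (mx_eval G (0 +i* w)%C - (mx_eval G (0 +i* w)%C)^t*)),
      forall w0 : R, 0 < w0 -> is_mx_pole G (0 +i* w0)%C ->
        mx_pole_order G (0 +i* w0)%C = 1%N /\
        exists2 K0 : 'M[R[i]]_m,
          (s - (0 +i* w0)%C) *: ('i *: mx_eval G s) @[s --> (0 +i* w0)%C^'] --> K0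
          & psd K0 &
      is_mx_pole G 0 ->
        (mx_pole_order G 0 = 1%N \/ mx_pole_order G 0 = 2%N) /\
        (mx_pole_order G 0 = 2%N ->
         exists2 L : 'M[R[i]]_m,
           s ^+ 2 *: mx_eval G s @[s --> (0 : R[i])^'] --> L & psd L)].

(* Analyticity at a point: complex differentiability in a neighbourhood of it.
   For rf_eval g this excludes the poles whatever value it is given there, since
   it is unbounded near a pole and therefore not continuous at it. *)
Definition analytic_on (R : realType) (D : set R[i]) (f : R[i] -> R[i]) : Prop :=
  forall s, D s -> \forall z \near s, derivable (f : R[i]^o -> R[i]^o) z 1.

(* Main.v *)
Require Import Defs.
From mathcomp Require Import all_boot all_order all_algebra.
From mathcomp Require Import sesquilinear complex.
From mathcomp Require Import all_classical all_reals all_analysis.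
From mathcomp Require Import ring lra.
Import Order.TTheory GRing.Theory Num.Theory.
Import numFieldNormedType.Exports Normc.
Local Open Scope classical_set_scope.
Local Open Scope ring_scope.
Set Implicit Arguments.
Unset Strict Implicit.
Unset Printing Implicit Defensive.

(** Since [j (z - z^* )] is [- 2 Im z], both sides say that [Im G] is nonpositive:
    on the imaginary half axis, with conditions at the poles there, or on the
    whole closed first quadrant.

    From the axis to the quadrant ([quadrant_le0], applied in
    [negative_imaginary_quadrant]) this is the maximum principle, which for
    rational functions is elementary.  Near an interior point [s],
    [G - G(s)] behaves like [u (z - s)^k] with [u] nonzero, and turning around
    [s] makes the imaginary part of [u (z - s)^k] positive somewhere
    ([no_interior_max]).  So it is enough that, for [eta > 0], the set of points
    of the quadrant with [Im G >= eta] is compact and avoids the boundary.  This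
    asks that [Im G < eta] close to the poles and far away:
    - at a pole [w = j y] with [y > 0], [G = - j k / (z - w) + H] with [k >= 0];
      the polar part has nonpositive imaginary part on the right half plane and
      is real on the axis, so the axis condition passes to [H]
      ([imaginary_pole_lt]);
    - at the origin, [G = a / z^2 + b / z + H] with [a], [b] and [H(0)] real;
      [a >= 0] is assumed for a double pole, [b >= 0] is forced by the axis
      condition, and both polar terms then have nonpositive imaginary part on
      the quadrant ([origin_pole_lt]);
    - at infinity, a proper [G] tends to a real limit ([infinity_lt]).

    In the other direction, let [w] be a pole of order [m] on the axis with
    leading coefficient [u].  Approaching [w] along the ray of direction
    [v] inside the quadrant gives [Im (u v^-m) <= 0] ([Im_polar_ray]).  If
    [w] is not the origin, the admissible directions fill a half plane, which
    forces [m = 1] and [j u >= 0] ([cis_sector_le0]); at the origin they fill a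
    quarter plane and [u] is real, which forces [m <= 2] and [u >= 0]
    ([quadrant_negative_imaginary]). *)

(** * Rational functions over a field *)

Lemma derivable_horner_num (K : numFieldType) (p : {poly K}) (s : K) :
  derivable (fun z : K => p.[z]) s 1.
Proof.
elim/poly_ind: p s => [|p c IH] s.
  under eq_fun do rewrite horner0.
  exact: derivable_cst.
under eq_fun do rewrite hornerMXaddC.
by apply: derivableD => //; apply: derivableM => //; exact: derivable_id.
Qed.

Lemma derivable_ratio (K : numFieldType) (N D : {poly K}) (s : K) :
  D.[s] != 0 -> derivable (fun z : K => N.[z] / D.[z]) s 1.
Proof.
move=> Ds; apply: derivableM; first exact: derivable_horner_num.
by apply: derivableV => //; exact: derivable_horner_num.
Qed.

Lemma ratio_continuous (K : numFieldType) (N D : {poly K}) (s : K) :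
  D.[s] != 0 -> {for s, continuous (fun z : K => N.[z] / D.[z])}.
Proof.
move=> Ds; apply: differentiable_continuous.
by apply/derivable1_diffP; exact: derivable_ratio.
Qed.

Lemma mup_cofactor (K : fieldType) (D : {poly K}) (w : K) : D != 0 ->
  exists2 E : {poly K}, D = ('X - w%:P) ^+ mup w D * E & E.[w] != 0.
Proof.
move=> D0; have /dvdpP[E DE] : ('X - w%:P) ^+ mup w D %| D by rewrite -mup_geq.
exists E; first by rewrite mulrC.
apply/negP => /eqP E0; have := mup_leq w (mup w D) D0.
rewrite leqnn => /esym; apply/negP; rewrite negbK.
have /factor_theorem[F EF] : root E w by apply/eqP.
by rewrite [X in _ %| X]DE EF -mulrA -exprS dvdp_mull.
Qed.

(** One step of the expansion at [a]: [N / E] minus its value at [a] vanishes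
    at [a], and the root is divided out. *)
Lemma divide_out_root (K : fieldType) (N E : {poly K}) (a : K) : E.[a] != 0 ->
  exists q : {poly K}, N = (N.[a] / E.[a])%:P * E + ('X - a%:P) * q.
Proof.
move=> Ea.
have /factor_theorem[q qE] : root (N - (N.[a] / E.[a])%:P * E) a.
  by rewrite /root !hornerE divfK// subrr.
by exists q; rewrite [_ * q]mulrC -qE addrC subrK.
Qed.

(** The degree of [p] is at most [k - 1]; the factor [`|z|] on the left stands for
    the missing power, so that [k = 0] is no exception. *)
Lemma horner_norm_bound (K : numFieldType) (p : {poly K}) k : (size p <= k)%N ->
  exists2 M : K, 0 <= M & forall z : K, 1 <= `|z| -> `|p.[z]| * `|z| <= M * `|z| ^+ k.
Proof.
move=> pk; exists (\sum_(i < k) `|p`_i|); first by apply: sumr_ge0.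
move=> z z1; rewrite (horner_coef_wide z pk).
have z0 : 0 < `|z| by apply: lt_le_trans z1.
apply: le_trans (_ : (\sum_(i < k) `|p`_i| * `|z| ^+ i) * `|z| <= _).
  by rewrite ler_pM2r//; apply: le_trans (ler_norm_sum _ _ _) _; apply: ler_sum => i _; rewrite normrM normrX.
rewrite !mulr_suml; apply: ler_sum => i _.
by rewrite -mulrA -exprSr ler_wpM2l// ler_weXn2l.
Qed.

(** * The complex plane with its real modulus *)

Section ComplexPlane.
Variable R : realType.
Local Notation C := R[i].
Local Notation Re := complex.Re.
Local Notation Im := complex.Im.
Implicit Types (p q N D E : {poly C}) (s z u v w : C).

Lemma normcE_norm z : `|z| = (normc z)%:C%C. Proof. by []. Qed.

(** Neighbourhoods in [R[i]] are given by radii in [R[i]]; a positive radius is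
    real, so that all estimates below can be made with the real modulus [normc]. *)
Lemma nbhs_normcP (s : C) (P : set C) :
  (\forall z \near s, P z) <->
  exists2 d : R, 0 < d & forall z, normc (z - s) < d -> P z.
Proof.
split=> [h|[d d0 hd]].
  have /nbhs_ballP [e /= e0 he] : nbhs (s : C^o) P by exact: h.
  have [d de] : exists d : R, e = d%:C%C.
    by exists (Re e); rewrite RRe_real// gtr0_real.
  exists d; first by rewrite de ltcR in e0.
  move=> z hz; apply: he.
  by rewrite /ball /= distrC de normcE_norm ltcR.
have : nbhs (s : C^o) P; last exact.
apply/nbhs_ballP; exists (d%:C)%C; first by rewrite /= ltcR.
by move=> z; rewrite /ball /= distrC normcE_norm ltcR; exact: hd.
Qed.

Lemma ratio_near N D s : D.[s] != 0 -> forall e : R, 0 < e ->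
  exists2 d : R, 0 < d & forall z, normc (z - s) < d ->
    normc (N.[z] / D.[z] - N.[s] / D.[s]) < e.
Proof.
move=> Ds e e0; apply/nbhs_normcP.
have /cvgrPdist_lt/(_ (e%:C)%C) := @ratio_continuous (R[i] : numFieldType) N D s Ds.
rewrite ltcR => /(_ e0) h.
have : nbhs (s : C^o) (fun z => normc (N.[z] / D.[z] - N.[s] / D.[s]) < e); last by [].
apply: filterS h => z.
by rewrite distrC normcE_norm ltcR.
Qed.

Lemma normc_Re_le z : `|Re z| <= normc z.
Proof. by rewrite -lecR; exact: normc_ge_Re. Qed.

Lemma normc_Im_le z : `|Im z| <= normc z.
Proof.
case: z => x y /=; rewrite -sqrtr_sqr ler_sqrt ?lerDr ?sqr_ge0//.
by rewrite addr_ge0 ?sqr_ge0.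
Qed.

Lemma normc_le z : normc z <= `|Re z| + `|Im z|.
Proof.
case: z => x y /=; rewrite -[leRHS]ger0_norm ?addr_ge0// -sqrtr_sqr.
rewrite ler_sqrt ?sqr_ge0// sqrrD !real_normK ?num_real//.
by rewrite -addrA [_ *+ 2 + _]addrC addrA lerDl mulrn_wge0// mulr_ge0.
Qed.

Lemma normcZ (t : R) z : 0 <= t -> normc (t%:C%C * z) = t * normc z.
Proof. by move=> t0; rewrite normcM /= expr0n addr0 sqrtr_sqr ger0_norm. Qed.

Lemma Im_ratio_near N D s : D.[s] != 0 -> forall e : R, 0 < e ->
  exists2 d : R, 0 < d & forall z, normc (z - s) < d ->
    `|Im (N.[z] / D.[z]) - Im (N.[s] / D.[s])| < e.
Proof.
move=> Ds e e0; have [d d0 hd] := ratio_near N Ds e0.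
exists d => // z /hd; apply: le_lt_trans.
have -> : Im (N.[z] / D.[z]) - Im (N.[s] / D.[s]) = Im (N.[z] / D.[z] - N.[s] / D.[s]).
  by case: (N.[z] / D.[z]) => a b; case: (N.[s] / D.[s]).
exact: normc_Im_le.
Qed.

(** A continuous function that is nonpositive along a ray is nonpositive at its
    origin. *)
Lemma Im_ratio_ray N D s v : D.[s] != 0 ->
  (exists2 e : R, 0 < e & forall t : R, 0 < t -> t < e ->
     Im (N.[s + t%:C%C * v] / D.[s + t%:C%C * v]) <= 0) ->
  Im (N.[s] / D.[s]) <= 0.
Proof.
move=> Ds [e e0 he]; rewrite leNgt; apply/negP => I0.
have [d d0 hd] := Im_ratio_near N Ds I0.
have v1 : 0 < normc v + 1 by rewrite ltr_wpDl// (le_trans _ (normc_Re_le v)).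
(* [t] is below [e] and small enough for [s + t v] to be in the disc of [hd]. *)
pose t := Num.min (e / 2) (d / (normc v + 1) / 2).
have t0 : 0 < t by rewrite /t lt_min !divr_gt0.
have te : t < e by rewrite /t gt_min ltr_pdivrMr// ltr_pMr// ltr1n.
have td : t * (normc v + 1) < d.
  rewrite -ltr_pdivlMr// /t gt_min; apply/orP; right.
  by rewrite ltr_pdivrMr// ltr_pMr ?divr_gt0// ltr1n.
have := he t t0 te.
have /hd : normc (s + t%:C%C * v - s) < d.
  rewrite addrC addKr normcZ ?ltW//; apply: le_lt_trans td.
  by rewrite ler_pM2l// lerDl.
rewrite distrC => /(le_lt_trans (ler_norm _)).
rewrite ltrBlDr ltrDl => h1 h2.
by move: (lt_le_trans h1 h2); rewrite ltxx.
Qed.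

Lemma horner_near_neq0 D s : D.[s] != 0 ->
  exists2 d : R, 0 < d & forall z, normc (z - s) < d -> D.[z] != 0.
Proof.
move=> Ds; have n0 : 0 < normc D.[s].
  by rewrite -ltcR -normcE_norm normr_gt0.
have one : (1 : {poly C}).[s] != 0 by rewrite hornerC oner_neq0.
have [d d0 hd] := ratio_near D one n0.
exists d => // z /hd; rewrite !hornerC !divr1 => h.
apply: contraTneq h => ->; rewrite sub0r -leNgt.
by rewrite -lecR -!normcE_norm normrN.
Qed.

(** * Directions and leading terms *)

Definition cis (x : R) : C := (cos x +i* sin x)%C.

Lemma cisX (x : R) m : cis x ^+ m = cis (m%:R * x).
Proof.
elim: m => [|m IH]; first by rewrite expr0 mul0r /cis cos0 sin0.
rewrite exprS IH /cis mulrSr mulrDl mul1r addrC cosD sinD; simpc.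
by congr (_ +i* _)%C; rewrite addrC.
Qed.

Lemma cisN (x : R) : cis (- x) * cis x = 1.
Proof.
rewrite /cis cosN sinN; simpc; rewrite -!expr2 cos2Dsin2 mulrC addrC.
by rewrite addNr.
Qed.

Lemma cis_neq0 (x : R) : cis x != 0.
Proof. by apply: contraTneq (oner_neq0 C) => c0; rewrite -(cisN x) c0 mulr0 eqxx. Qed.

Lemma cisV (x : R) : (cis x)^-1 = cis (- x).
Proof. by rewrite -[LHS]mul1r -(cisN x) mulfK ?cis_neq0. Qed.

Lemma ImD z1 z2 : Im (z1 + z2) = Im z1 + Im z2.
Proof. by case: z1; case: z2. Qed.

Lemma ImZ (t : R) z : Im (t%:C%C * z) = t * Im z.
Proof. by case: z => a b /=; rewrite mul0r addr0. Qed.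

(** When [x] runs through the half circle, [m x] runs through an arc of length
    [m pi] centred at [0].  It always contains the angles [pi / 2] and
    [- pi / 2], which kill [Re u]; for [m >= 2] it also contains [0] and
    [pi], which kill [Im u]. *)
Lemma cis_sector_le0 u m : (0 < m)%N ->
  (forall x : R, - (pi / 2) <= x <= pi / 2 -> Im (u * cis (m%:R * x)) <= 0) ->
  Re u = 0 /\ ((1 < m)%N -> u = 0).
Proof.
move=> m0 h.
have mR : (m%:R : R) != 0 by rewrite pnatr_eq0 -lt0n.
have p2 : 0 < pi / 2 :> R by rewrite divr_gt0// pi_gt0.
have m1 : 1 <= m%:R :> R by rewrite ler1n.
have mp : (pi / 2) / m%:R <= pi / 2 :> R by rewrite ler_pdivrMr ?ltr0n// ler_peMr// ltW.
have mp0 : 0 < (pi / 2) / m%:R :> R by rewrite divr_gt0// ltr0n.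
have Re0 : Re u = 0.
  have h1 : Im (u * cis (pi / 2)) <= 0.
    have -> : pi / 2 = m%:R * (pi / 2 / m%:R) :> R by rewrite mulrCA mulfV// mulr1.
    by apply: h; rewrite mp andbT; lra.
  have h2 : Im (u * cis (- (pi / 2))) <= 0.
    have -> : - (pi / 2) = m%:R * (- (pi / 2 / m%:R)) :> R.
      by rewrite mulrN mulrCA mulfV// mulr1.
    by apply: h; lra.
  move: h1 h2; rewrite /cis cosN sinN cos_pihalf sin_pihalf.
  case: u {h} => a b /=; lra.
split=> // m2.
have h1 : Im u <= 0.
  have := h 0; rewrite mulr0 /cis cos0 sin0 mulr1; apply.
  by rewrite oppr_le0 ltW.
have h2 : Im (u * cis pi) <= 0.
  have -> : pi = m%:R * (pi / m%:R) :> R by rewrite mulrCA mulfV// mulr1.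
  apply: h; have : pi / m%:R <= pi / 2 :> R.
    by rewrite ler_pM2l ?pi_gt0// lef_pV2 ?posrE ?ltr0n// ler_nat.
  have : 0 < pi / m%:R :> R by rewrite divr_gt0 ?pi_gt0 ?ltr0n.
  by move=> *; lra.
move: h1 h2 Re0; rewrite /cis cospi sinpi.
case: u {h} => a b /=; rewrite mulr0 add0r mulrN1 => h1 h2 ->.
by apply/eqP; rewrite eq_complex /= eqxx /=; apply/eqP; lra.
Qed.

(** On [w + t v] the quotient of [N] by [(X - w)^m E] is [t^-m] times a quantity
    that tends to [N(w) / E(w) * v^-m] when [t] tends to [0]. *)
Lemma Im_polar_ray N E w v m : E.[w] != 0 ->
  (exists2 e : R, 0 < e & forall t : R, 0 < t -> t < e ->
     Im (N.[w + t%:C%C * v] / (('X - w%:P) ^+ m * E).[w + t%:C%C * v]) <= 0) ->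
  Im (N.[w] / E.[w] * (v^-1) ^+ m) <= 0.
Proof.
move=> Ep [e e0 he].
have -> : N.[w] / E.[w] * v^-1 ^+ m = (v^-1 ^+ m *: N).[w] / E.[w].
  by rewrite hornerZ mulrC mulrA.
apply: (@Im_ratio_ray _ _ _ v) => //; exists e => // t t0 te.
have := he t t0 te; rewrite hornerM horner_exp !hornerE addrAC subrr add0r.
have tC : t%:C%C != 0 :> C by rewrite gt_eqF// ltcR.
have -> : (v^-1) ^+ m * N.[w + t%:C%C * v] / E.[w + t%:C%C * v] =
  (t ^+ m)%:C%C * (N.[w + t%:C%C * v] / ((t%:C%C * v) ^+ m * E.[w + t%:C%C * v])).
  rewrite exprMn !invfM rmorphXn /= exprVn.
  have : t%:C%C ^+ m != 0 :> C by rewrite expf_neq0.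
  by move=> T0; rewrite -!mulrA mulrCA [RHS]mulrCA mulVKf.
rewrite ImZ => h; rewrite mulr_ge0_le0// exprn_ge0 ?ltW//.
Qed.

(** Unless [N / D] is constant, its variation at [s] is [u (z - s)^k] to leading
    order with [k > 0] and [u != 0].  A maximum of [Im (N / D)] at [s] would make
    [Im (u v^k)] nonpositive in every direction [v], which fails since [v^k] takes
    every argument. *)
Lemma no_interior_max N D s : D.[s] != 0 ->
  (exists2 e : R, 0 < e & forall z, normc (z - s) < e ->
     Im (N.[z] / D.[z]) <= Im (N.[s] / D.[s])) ->
  N = (N.[s] / D.[s])%:P * D.
Proof.
move=> Ds [e e0 he]; set c := N.[s] / D.[s].
apply/eqP; rewrite -subr_eq0; apply/negPn/negP => M0.
have [E ME Es] := mup_cofactor s M0.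
set k := mup s _ in ME.
have Ms : (N - c%:P * D).[s] = 0 by rewrite !hornerE /c divfK// subrr.
have k0 : (0 < k)%N.
  rewrite lt0n; apply/eqP => k0; move: Ms.
  by rewrite ME k0 expr0 mul1r => E0; rewrite E0 eqxx in Es.
have [d d0 hd] := horner_near_neq0 Ds.
(* [2 x] covers the full circle when [x] covers the half circle, hence [m := 2]. *)
suff h y : Im (E.[s] / D.[s] * cis y) <= 0.
  have [_ /(_ isT)/eqP] := @cis_sector_le0 (E.[s] / D.[s]) 2 isT (fun x _ => h _).
  by rewrite mulf_eq0 invr_eq0 (negbTE Es) (negbTE Ds).
pose v := cis (y / k%:R).
have vk : v ^+ k = cis y.
  by rewrite cisX mulrCA mulfV ?mulr1// pnatr_eq0 -lt0n.
have -> : E.[s] / D.[s] * cis y = (v ^+ k *: E).[s] / D.[s].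
  by rewrite hornerZ vk mulrC mulrA.
have v1 : 0 < normc v + 1 by rewrite ltr_wpDl// (le_trans _ (normc_Re_le v)).
pose r := Num.min d e.
have r0 : 0 < r by rewrite /r lt_min d0 e0.
apply: (@Im_ratio_ray _ _ _ v) => //; exists (r / (normc v + 1)).
  by rewrite divr_gt0.
move=> t t0; rewrite ltr_pdivlMr// => tr; set z := s + _.
have zr : normc (z - s) < r.
  rewrite /z addrC addKr normcZ ?ltW//; apply: le_lt_trans tr.
  by rewrite ler_pM2l// lerDl.
have Dz : D.[z] != 0 by apply: hd; apply: lt_le_trans zr _; rewrite /r ge_min lexx.
have : Im (N.[z] / D.[z]) <= Im c.
  by apply: he; apply: lt_le_trans zr _; rewrite /r ge_min lexx orbT.
have -> : N.[z] / D.[z] = c + (t ^+ k)%:C%C * ((v ^+ k *: E).[z] / D.[z]).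
  have -> : N.[z] = c * D.[z] + (N - c%:P * D).[z] by rewrite hornerD hornerN hornerCM addrC subrK.
  have -> : (N - c%:P * D).[z] = (t ^+ k)%:C%C * (v ^+ k * E.[z]).
    rewrite ME hornerM horner_exp hornerXsubC /z addrAC subrr add0r.
    by rewrite exprMn rmorphXn mulrA.
  by rewrite mulrDl mulfK// hornerZ !mulrA.
rewrite [Im (c + _)]ImD ImZ gerDl => h.
by rewrite -(pmulr_rle0 _ (exprn_gt0 k t0)).
Qed.

Lemma imag_neq0 (t : R) : 0 < t -> (0 +i* t)%C != 0.
Proof. by move=> t0; rewrite eq_complex /= (gt_eqF t0) andbF. Qed.

Lemma normc_imag (t : R) : 0 <= t -> normc (0 +i* t)%C = t.
Proof. by move=> t0; rewrite /= expr0n add0r sqrtr_sqr ger0_norm. Qed.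

(** * Behaviour near boundary poles and at infinity *)

Lemma ReV z : Re z^-1 = Re z / (Re z ^+ 2 + Im z ^+ 2).
Proof. by case: z. Qed.

Lemma ImV z : Im z^-1 = - (Im z / (Re z ^+ 2 + Im z ^+ 2)).
Proof. by case: z => a b /=; rewrite ?mulNr. Qed.

Lemma ReV_ge0 z : 0 <= Re z -> 0 <= Re z^-1.
Proof. by move=> z0; rewrite ReV divr_ge0// addr_ge0 ?sqr_ge0. Qed.

Lemma ImV_le0 z : 0 <= Im z -> Im z^-1 <= 0.
Proof. by move=> z0; rewrite ImV oppr_le0 divr_ge0// addr_ge0 ?sqr_ge0. Qed.

Lemma Im_sqr z : Im (z ^+ 2) = 2 * (Re z * Im z).
Proof. by case: z => a b; rewrite expr2 /=; ring. Qed.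

Lemma simple_pole_split N E q w z : E.[z] != 0 -> z != w ->
  N = (N.[w] / E.[w])%:P * E + ('X - w%:P) * q ->
  N.[z] / ((z - w) * E.[z]) = N.[w] / E.[w] / (z - w) + q.[z] / E.[z].
Proof.
move=> Ez zw NE; rewrite {1}NE !hornerE.
have zw0 : z - w != 0 by rewrite subr_eq0.
by move: (N.[w] / E.[w]) (E.[z]) (q.[z]) Ez => c e r Ez; field; rewrite Ez.
Qed.

(** Write the quotient as [c / (z - w) + H] with [c = - j k].  Then
    [Im (c / (z - w)) = - k Re ((z - w)^-1)] is nonpositive on the right half
    plane and vanishes on the axis.  Hence [Im H] is nonpositive on the axis near
    [w], so at [w], and [Im H < eta] around [w]. *)
Lemma imaginary_pole_lt N E (y0 k : R) (w := (0 +i* y0)%C) :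
  E.[w] != 0 -> 0 < y0 -> 0 <= k -> N.[w] / E.[w] = (0 -i* k)%C ->
  (forall y : R, 0 <= y -> (('X - w%:P) * E).[(0 +i* y)%C] != 0 ->
     Im (N.[(0 +i* y)%C] / (('X - w%:P) * E).[(0 +i* y)%C]) <= 0) ->
  forall eta : R, 0 < eta -> exists2 d : R, 0 < d &
    forall z, 0 <= Re z -> (('X - w%:P) * E).[z] != 0 -> normc (z - w) < d ->
      Im (N.[z] / (('X - w%:P) * E).[z]) < eta.
Proof.
move=> Ew y00 k0 Nk axis eta eta0.
have [q qE] := divide_out_root N Ew.
have split z : (('X - w%:P) * E).[z] != 0 ->
    N.[z] / (('X - w%:P) * E).[z] = (0 -i* k)%C / (z - w) + q.[z] / E.[z].
  rewrite hornerM hornerXsubC mulf_eq0 negb_or subr_eq0 => /andP[zw Ez].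
  by rewrite (simple_pole_split Ez zw qE) Nk.
have Iq : Im (q.[w] / E.[w]) <= 0.
  have [d d0 hd] := horner_near_neq0 Ew.
  apply: (@Im_ratio_ray _ _ _ ('i)%C) => //; exists d => // t t0 td.
  have zE : w + t%:C%C * 'i%C = (0 +i* (y0 + t))%C.
    by rewrite /w; simpc.
  have pw : w + t%:C%C * 'i%C - w = (0 +i* t)%C.
    by rewrite addrAC subrr add0r; simpc.
  have Dz : (('X - w%:P) * E).[w + t%:C%C * 'i%C] != 0.
    rewrite hornerM hornerXsubC pw mulf_neq0//.
      exact: imag_neq0.
    by apply: hd; rewrite pw normc_imag// ltW.
  have := axis (y0 + t) (addr_ge0 (ltW y00) (ltW t0)).
  rewrite -zE => /(_ Dz); rewrite split// ImD.
  suff -> : Im ((0 -i* k)%C / (w + t%:C%C * 'i%C - w)) = 0 by rewrite add0r.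
  by rewrite pw /= !(mul0r, mulr0, oppr0, addr0).
have [d d0 hd] := Im_ratio_near q Ew eta0.
exists d => // z z0 Dz /hd zd; rewrite split// ImD.
suff : Im ((0 -i* k)%C / (z - w)) <= 0.
  by move: zd; rewrite ltr_norml => /andP[_]; lra.
have : 0 <= Re (z - w)^-1 by apply: ReV_ge0; case: z z0 {Dz zd} => a b /=; rewrite subr0.
by case: ((z - w)^-1) => a b /= a0; rewrite mul0r add0r mulNr oppr_le0 mulr_ge0.
Qed.

(** Both [Im (z^-2)] and [Im (z^-1)] are nonpositive on the first quadrant, so
    only the sign of [b] is missing.  At [z = j t] the term [a / z^2] is real and
    [t Im G = - b + t Im (Q / E)]; letting [t] tend to [0] gives [- b <= 0]. *)
Lemma origin_pole_lt (a b : R) Q E (G : C -> C) :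
  E.[0] != 0 -> 0 <= a -> Im (Q.[0] / E.[0]) = 0 ->
  (forall z, z != 0 -> E.[z] != 0 ->
    G z = a%:C%C * z^-1 ^+ 2 + b%:C%C * z^-1 + Q.[z] / E.[z]) ->
  (forall y : R, 0 < y -> E.[(0 +i* y)%C] != 0 -> Im (G (0 +i* y)%C) <= 0) ->
  forall eta : R, 0 < eta -> exists2 d : R, 0 < d &
    forall z, 0 <= Re z -> 0 <= Im z -> z != 0 -> E.[z] != 0 -> normc z < d ->
      Im (G z) < eta.
Proof.
move=> E0 a0 Q0 GE axis eta eta0.
have b0 : 0 <= b.
  (* [F / E] at [z = j t] is [t (b / z + Q / E)], and its value at [0] is [- j b]. *)
  pose F := (- 'i%C)%:P * (b%:C%C%:P * E + 'X * Q).
  have : Im (F.[0] / E.[0]) <= 0.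
    have [d d0 hd] := horner_near_neq0 E0.
    apply: (@Im_ratio_ray _ _ _ ('i)%C) => //; exists d => // t t0 td.
    rewrite add0r.
    have tE : t%:C%C * 'i%C = (0 +i* t)%C by simpc.
    have z0 : t%:C%C * 'i%C != 0 by rewrite tE imag_neq0.
    have Ez : E.[t%:C%C * 'i%C] != 0.
      by apply: hd; rewrite subr0 tE normc_imag// ltW.
    have := axis t t0; rewrite -tE => /(_ Ez); rewrite GE// !ImD !ImZ.
    have -> : Im ((t%:C%C * 'i%C)^-1 ^+ 2) = 0 by rewrite Im_sqr ReV tE /= !(mul0r, mulr0).
    rewrite mulr0 add0r => h.
    have -> : F.[t%:C%C * 'i%C] / E.[t%:C%C * 'i%C] =
       t%:C%C * (b%:C%C * (t%:C%C * 'i%C)^-1 + Q.[t%:C%C * 'i%C] / E.[t%:C%C * 'i%C]).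
      have i1 : - 'i%C * 'i%C = 1 :> C by simpc.
      have tz : t%:C%C = - 'i%C * (t%:C%C * 'i%C) :> C by rewrite mulrCA i1 mulr1.
      rewrite /F !hornerE.
      move: (t%:C%C * 'i%C) tz z0 Ez => z -> z0 Ez; field; by rewrite z0 Ez.
    by rewrite ImZ ImD ImZ mulr_ge0_le0// ltW.
  have -> : F.[0] / E.[0] = - 'i%C * b%:C%C by rewrite /F !hornerE mulfK.
  by simpc; rewrite /= oppr_le0.
have [d d0 hd] := Im_ratio_near Q E0 eta0.
exists d => // z rz iz z0 Ez zd.
have := hd z; rewrite subr0 => /(_ zd); rewrite Q0 subr0 => zd'.
have h1 := mulr_ge0_le0 a0 (mulr_ge0_le0 (ltW (@ltr0Sn R 1)) (mulr_ge0_le0 (ReV_ge0 rz) (ImV_le0 iz))).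
have h2 := mulr_ge0_le0 b0 (ImV_le0 iz).
rewrite GE// !ImD !ImZ Im_sqr.
by move: zd'; rewrite ltr_norml => /andP[_] h3; move: h1 h2; lra.
Qed.

Lemma complex_poly_bound (p : {poly R}) k : (size p <= k)%N ->
  exists2 M : R, 0 <= M & forall z, 1 <= normc z ->
    normc (complex_poly p).[z] * normc z <= M * normc z ^+ k.
Proof.
move=> pk; have := @horner_norm_bound (R[i] : numFieldType) (complex_poly p) k.
rewrite size_map_poly => /(_ pk) [M M0 hM].
exists (Re M); first by rewrite -ler0c RRe_real// ger0_real.
move=> z z1; rewrite -lecR !rmorphM rmorphXn /= RRe_real ?ger0_real//.
by rewrite -!normcE_norm hM// normcE_norm -(rmorph1 (real_complex R)) lecR.
Qed.

(** With [c] the quotient of the leading coefficients, [n / d - c] is a quotient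
    [r / d] where [r] has smaller degree than [d], and [c] is real. *)
Lemma infinity_lt (n d : {poly R}) (N := complex_poly n) (D := complex_poly d) :
  d != 0 -> (size n <= size d)%N -> forall eta : R, 0 < eta ->
  exists B : R, forall z, B <= normc z -> Im (N.[z] / D.[z]) < eta.
Proof.
move=> d0 nd eta eta0.
pose k := (size d).-1; pose c := n`_k / d`_k.
have dk : size d = k.+1 by rewrite /k prednK// size_poly_gt0.
have lc0 : d`_k != 0 by rewrite -lead_coefE lead_coef_eq0.
have sr : (size (n - c *: d)%R <= k)%N.
  apply/leq_sizeP => j; rewrite leq_eqVlt coefB coefZ => /predU1P[<-|kj].
    by rewrite /c divfK// subrr.
  by rewrite !nth_default ?mulr0 ?subrr// ?(leq_trans nd) ?dk.
have sl : (size (d - d`_k *: 'X^k)%R <= k)%N.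
  apply/leq_sizeP => j; rewrite leq_eqVlt coefB coefZ coefXn => /predU1P[<-|kj].
    by rewrite eqxx mulr1 subrr.
  by rewrite nth_default ?dk// gtn_eqF// mulr0 subr0.
have [m1 m10 h1] := complex_poly_bound sr; have [m2 m20 h2] := complex_poly_bound sl.
have [L LE] : exists L : R, L = `|d`_k| by exists `|d`_k|.
 have L0 : 0 < L by rewrite LE normr_gt0.
have eL : 0 < eta * L by rewrite mulr_gt0.
(* [m2]: [d] is at least half its leading term; [m1]: [r] is below [eta] times it. *)
exists (1 + (2 * m2 / L + 2 * m1 / (eta * L)) + 1) => z Bz.
have p1 : 0 <= 2 * m2 / L by rewrite divr_ge0 ?mulr_ge0// ltW.
have p2 : 0 <= 2 * m1 / (eta * L) by rewrite divr_ge0 ?mulr_ge0// ltW.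
have z1 : 1 <= normc z by move: Bz p1 p2; lra.
have z0 : 0 < normc z by apply: lt_le_trans z1.
have q2 : 2 * m2 <= L * normc z.
  by rewrite -ler_pdivrMl// mulrC; move: Bz p1 p2; lra.
have q1 : 2 * m1 < eta * L * normc z.
  by rewrite -ltr_pdivrMl// mulrC; move: Bz p1 p2; lra.
have X0 : 0 < normc z ^+ k by rewrite exprn_gt0.
have r1 := h1 z z1; have r2 := h2 z z1.
have NE : N.[z] = c%:C%C * D.[z] + (complex_poly (n - c *: d)).[z].
  by rewrite /complex_poly rmorphB /= map_polyZ hornerD hornerN hornerZ addrC subrK.
have DE : D.[z] = (d`_k)%:C%C * z ^+ k + (complex_poly (d - d`_k *: 'X^k)).[z].
  by rewrite /complex_poly rmorphB /= map_polyZ map_polyXn hornerD hornerN hornerZ hornerXn addrC subrK.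
set r := (complex_poly (n - _)).[z] in r1 NE.
set l := (complex_poly (d - _)).[z] in r2 DE.
have dz : L * normc z ^+ k <= normc D.[z] + normc l.
  rewrite -lecR rmorphD /= rmorphM /= rmorphXn /= -!normcE_norm.
  have -> : L%:C%C = `|(d`_k)%:C%C| :> C by rewrite normcE_norm /= expr0n addr0 sqrtr_sqr LE.
  rewrite -normrX -normrM.
  have -> : (d`_k)%:C%C * z ^+ k = D.[z] - l by rewrite DE addrK.
  exact: ler_normB.
have ll : normc l * 2 <= L * normc z ^+ k by nra.
have rr : normc r * 2 < eta * L * normc z ^+ k by nra.
have Dz : 0 < normc D.[z] by have := mulr_gt0 L0 X0; lra.
have rD : normc r < eta * normc D.[z] by nra.
have Dz0 : D.[z] != 0 by apply: contraTneq Dz => ->; rewrite normc0 ltxx.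
rewrite NE mulrDl mulfK// ImD /= add0r.
apply: le_lt_trans (ler_norm _) _; apply: le_lt_trans (normc_Im_le _) _.
by rewrite normcM normcV ltr_pdivrMr.
Qed.

(** * The maximum principle on the first quadrant *)

(** Compactness is used in [R * R], whose bounded closed boxes are known to be
    compact; this transports neighbourhoods from [R[i]]. *)
Lemma nbhs_plane (x0 : R * R) (P : C -> Prop) (d : R) : 0 < d ->
  (forall z, normc (z - (x0.1 +i* x0.2)%C) < d -> P z) ->
  \forall x \near x0, P (x.1 +i* x.2)%C.
Proof.
move=> d0 h; apply/nbhs_ballP; exists (d / 2); first by rewrite /= divr_gt0.
move=> x [h1 h2]; apply: h.
have -> : (x.1 +i* x.2)%C - (x0.1 +i* x0.2)%C = ((x.1 - x0.1) +i* (x.2 - x0.2))%C by simpc.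
apply: le_lt_trans (normc_le _) _ => /=.
move: h1 h2; rewrite /ball /= [`|x0.1 - _|]distrC [`|x0.2 - _|]distrC.
by lra.
Qed.

Lemma Im_real_ratio (n d : {poly R}) (x : R) :
  Im ((complex_poly n).[x%:C%C] / (complex_poly d).[x%:C%C]) = 0.
Proof. by rewrite /complex_poly !horner_map -fmorph_div. Qed.

(** Maximum principle on the first quadrant.  If the value at some point is
    [eta > 0], the points of the quadrant with value at least [eta] form a bounded
    set, by the behaviour at infinity, and a closed one, because the poles are not
    adherent to it.  The maximum is then attained, away from both half axes, hence
    at an interior point; so the quotient is constant, and real as the quotient of
    the leading coefficients. *)
Lemma quadrant_le0 (n d : {poly R}) (N := complex_poly n) (D := complex_poly d) :
  d != 0 -> (size n <= size d)%N ->
  (forall z, 0 < Re z -> D.[z] != 0) ->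
  (forall y : R, 0 <= y -> D.[(0 +i* y)%C] != 0 ->
     Im (N.[(0 +i* y)%C] / D.[(0 +i* y)%C]) <= 0) ->
  (forall y : R, 0 <= y -> D.[(0 +i* y)%C] = 0 -> forall eta : R, 0 < eta ->
     exists2 e : R, 0 < e & forall z, 0 <= Re z -> 0 <= Im z -> D.[z] != 0 ->
       normc (z - (0 +i* y)%C) < e -> Im (N.[z] / D.[z]) < eta) ->
  forall z, 0 <= Re z -> 0 <= Im z -> D.[z] != 0 -> Im (N.[z] / D.[z]) <= 0.
Proof.
move=> d0 nd rhp axis pole z rz iz Dz; rewrite leNgt; apply/negP.
set eta := Im _ => eta0.
pose f (x : R * R) := Im (N.[(x.1 +i* x.2)%C] / D.[(x.1 +i* x.2)%C]).
pose K := [set x : R * R | [/\ 0 <= x.1, 0 <= x.2, D.[(x.1 +i* x.2)%C] != 0 & eta <= f x]].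
have [B hB] := infinity_lt d0 nd eta0.
have fcont x : D.[(x.1 +i* x.2)%C] != 0 -> {for x, continuous f}.
  move=> Dx; apply/cvgrPdist_lt => e e0.
  have [r r0 hr] := Im_ratio_near N Dx e0.
  have := @nbhs_plane x (fun w => `|f x - Im (N.[w] / D.[w])| < e) r r0.
  by apply=> w /hr; rewrite distrC.
have Kbox : K `<=` `[0, B]%classic `*` `[0, B]%classic.
  move=> [x y] [/= x0 y0 Dxy fxy].
  have xyB : normc (x +i* y)%C < B.
    by rewrite ltNge; apply/negP => /hB; rewrite ltNge => /negP; apply.
  have := normc_Re_le (x +i* y)%C; have := normc_Im_le (x +i* y)%C.
  rewrite /Re /Im !in_itv /= x0 y0 !ger0_norm// => h1 h2.
  by split; apply/ltW/(le_lt_trans _ xyB).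
have Kclosed : closed K.
  move=> [x y] Kxy; set p := (x +i* y)%C.
  (* [p] is adherent to [K]: what holds close to [p] holds at some point of [K]. *)
  have near (P : C -> Prop) (r : R) : 0 < r -> (forall w, normc (w - p) < r -> P w) ->
      exists w, [/\ P w, 0 <= Re w, 0 <= Im w, D.[w] != 0 & eta <= Im (N.[w] / D.[w])].
    move=> r0 hr; have [x' [[? ? ? ?] Px]] := Kxy _ (@nbhs_plane (x, y) P r r0 hr).
    by exists (x'.1 +i* x'.2)%C.
  have x0 : 0 <= x.
    rewrite leNgt; apply/negP => x0.
    have [|w hw|w [+ + _ _ _]] := near (fun w => Re w < 0) (- x); first by rewrite oppr_gt0.
      have := le_lt_trans (normc_Re_le _) hw.
      case: w {hw} => a b /=; rewrite ltr_norml; lra.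
    by rewrite ltNge => /negP.
  have y0 : 0 <= y.
    rewrite leNgt; apply/negP => y0.
    have [|w hw|w [+ _ + _ _]] := near (fun w => Im w < 0) (- y); first by rewrite oppr_gt0.
      have := le_lt_trans (normc_Im_le _) hw.
      case: w {hw} => a b /=; rewrite ltr_norml; lra.
    by rewrite ltNge => /negP.
  have Dp : D.[p] != 0.
    apply/eqP => Dp.
    have x00 : x = 0.
      apply/eqP; rewrite eq_le x0 andbT leNgt; apply/negP => xp.
      by have := rhp p xp; rewrite Dp eqxx.
    have pE : (0 +i* y)%C = p by rewrite /p x00.
    have [|r r0 hr] := pole y y0 _ eta eta0; first by rewrite pE.
    rewrite pE in hr.
    have [w [wr w1 w2 w3]] := near (fun w => normc (w - p) < r) r r0 (fun _ => id).
    by rewrite leNgt hr.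
  split => //=; rewrite leNgt; apply/negP => fe.
  have [|r r0 hr] := @Im_ratio_near N D p Dp (eta - f (x, y)); first by rewrite subr_gt0.
  have [w [+ _ _ _]] := near _ _ r0 hr.
  by rewrite ltr_norml /f /= -/p => /andP[_]; lra.
have Kcpt : compact K.
  apply: subclosed_compact Kclosed _ Kbox.
  by apply: compact_setX; exact: segment_compact.
have K0 : K !=set0.
  have zE : (Re z +i* Im z)%C = z by case: (z).
  by exists (Re z, Im z); split; rewrite ?/f /= ?zE.
have fK : {within K, continuous f}.
  by apply: continuous_in_subspaceT => x /set_mem[_ _ Dx _]; exact: fcont.
have [[x y] /set_mem[/= x0 y0 Dxy fxy] fmax] := compact_EVT_max K0 Kcpt fK.
set p := (x +i* y)%C in Dxy.
have fp : Im (N.[p] / D.[p]) = f (x, y) by [].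
have xp : 0 < x.
  rewrite lt_neqAle x0 andbT; apply/eqP => x00.
  move: fxy; rewrite -fp leNgt => /negP; apply.
  by apply: le_lt_trans eta0; rewrite /p -x00 in Dxy *; exact: axis.
have yp : 0 < y.
  rewrite lt_neqAle y0 andbT; apply/eqP => y00.
  move: fxy; rewrite -fp leNgt => /negP; apply.
  by rewrite /p -y00 complexr0 Im_real_ratio.
have [r r0 hr] := horner_near_neq0 Dxy.
have /(no_interior_max Dxy) NE : exists2 e : R, 0 < e & forall w, normc (w - p) < e ->
    Im (N.[w] / D.[w]) <= Im (N.[p] / D.[p]).
  exists (Num.min r (Num.min x y)); first by rewrite !lt_min r0 xp yp.
  move=> [a b]; rewrite !lt_min => /and3P[wr wx wy].
  have [ew|/ltW we] := leP eta (Im (N.[(a +i* b)%C] / D.[(a +i* b)%C])); last exact: le_trans we _.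
  have := fmax (a, b); rewrite fp; apply; apply/mem_set; split => //=; last exact: hr.
    by have := le_lt_trans (normc_Re_le _) wx; rewrite /= ltr_norml; lra.
  by have := le_lt_trans (normc_Im_le _) wy; rewrite /= ltr_norml; lra.
(* Comparing the coefficients at the degree of [d] shows that the constant is real. *)
have lc0 : d`_(size d).-1 != 0 by rewrite -lead_coefE lead_coef_eq0.
have cE : N.[p] / D.[p] = (n`_(size d).-1 / d`_(size d).-1)%:C%C.
  rewrite rmorphM fmorphV; apply: (canRL (mulfK _)).
    by rewrite /= eq_complex /= negb_and lc0.
  have := congr1 (fun q : {poly C} => q`_(size d).-1) NE.
  by rewrite coefCM /N /D /complex_poly !coef_map.
by move: fxy; rewrite -fp cE /= leNgt eta0.
Qed.

(** * Limits and matrices of size 1 *)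

(** The limit at [w], through the real modulus; the value of [f] at [w], which is
    only a convention when [w] is a pole, does not count. *)
Definition limc (f : C -> C) w l := forall e : R, 0 < e -> exists2 d : R, 0 < d &
  forall z, z != w -> normc (z - w) < d -> normc (f z - l) < e.

Lemma mx1_cvgP (F : C -> 'M[C]_1) w (K : 'M[C]_1) :
  (F s @[s --> w^'] --> K) <-> limc (fun s => F s 0 0) w (K 0 0).
Proof.
split=> [h e e0|h P [Q KQ QP]].
  have : (F s @[s --> w^']) [set M | normc (M 0 0 - K 0 0) < e].
    apply: h; exists (fun i j => [set z | normc (z - K i j) < e]).
      by move=> i j; apply/nbhs_normcP; exists e.
    by move=> M; exact.
  move=> /nbhs_normcP[d d0 hd]; exists d => // z zw /hd; exact.
have /nbhs_normcP[e e0 he] := KQ 0 0.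
have [d d0 hd] := h e e0.
apply/nbhs_normcP; exists d => // z zd zw; apply: QP => i j.
by rewrite !ord1; apply: he; exact: hd.
Qed.

(** For [M] of size 1, the form [v^t* M v] is the entry of [M] times [|v|^2]. *)
Lemma psd1 (M : 'M[C]_1) : psd M <-> 0 <= M 0 0.
Proof.
rewrite /psd; split.
  move=> [_ /(_ 1%:M)].
  by rewrite trmx1 map_mx1 mul1mx mulmx1.
move=> M0; split.
  apply/is_hermitianmxP; rewrite expr0 scale1r.
  apply/matrixP => i j; rewrite !ord1 !mxE.
  by rewrite geC0_conj.
move=> v; rewrite !mxE big_ord1 !mxE big_ord1 !mxE.
by rewrite mulrAC mulr_ge0// mulrC mul_conjC_ge0.
Qed.

Lemma ge0_i_subJ z : (0 <= 'i * (z - z^*)%R) = (Im z <= 0).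
Proof.
have -> : 'i * (z - z^*) = (- (2 * Im z))%:C%C.
  case: z => a b; rewrite -complexiE.
  have -> : (a +i* b)%C^* = (a -i* b)%C by [].
  by simpc; congr (_ +i* _)%C; rewrite ?subrr//= mulr_natl mulr2n opprD.
by rewrite ler0c oppr_ge0 pmulr_rle0.
Qed.

Lemma limc_unique f w l l' : limc f w l -> limc f w l' -> l = l'.
Proof.
move=> h h'; apply/eqP; rewrite -subr_eq0; apply/negPn/negP => ll.
have e0 : 0 < normc (l - l') by rewrite -ltcR -normcE_norm normr_gt0.
have e2 : 0 < normc (l - l') / 2 by rewrite divr_gt0.
have [d d0 hd] := h _ e2; have [d' d'0 hd'] := h' _ e2.
pose t := Num.min d d' / 2.
have m0 : 0 < Num.min d d' by rewrite lt_min d0.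
have t0 : 0 < t by rewrite divr_gt0.
have tm : t < Num.min d d' by rewrite /t ltr_pdivrMr// ltr_pMr// ltr1n.
move: tm; rewrite lt_min => /andP[td td'].
pose z := w + (0 +i* t)%C.
have zw : z != w by rewrite -subr_eq0 /z addrAC subrr add0r imag_neq0.
have zn : normc (z - w) = t by rewrite /z addrAC subrr add0r normc_imag// ltW.
have h1 := hd z zw; have h2 := hd' z zw; rewrite zn in h1 h2.
have := le_normcD (l - f z) (f z - l').
rewrite addrA subrK -[normc (l - f z)]normcN opprB => h3.
move: (h1 td) (h2 td') => h4 h5.
by have := le_lt_trans h3 (ltrD h4 h5); rewrite -splitr ltxx.
Qed.

(** A function that agrees with [N / E] where [E] does not vanish has the limit
    read off from [N / E]; this computes the leading coefficient of [G] at a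
    pole. *)
Lemma limc_removable f w N E : E.[w] != 0 ->
  (forall z, z != w -> E.[z] != 0 -> f z = N.[z] / E.[z]) -> limc f w (N.[w] / E.[w]).
Proof.
move=> Ew fE e e0; have [d d0 hd] := ratio_near N Ew e0.
have [r r0 hr] := horner_near_neq0 Ew.
exists (Num.min d r); first by rewrite lt_min d0.
by move=> z zw; rewrite lt_min => /andP[zd zr]; rewrite fE ?hr// hd.
Qed.

(** * Negative imaginary scalar transfer functions *)

Section Scalar.
Variable G : {fraction {poly R}}.
Let N := complex_poly (rf_num G).
Let D := complex_poly (rf_den G).

Lemma cden_neq0 : D != 0.
Proof. by rewrite map_poly_eq0 rf_den_neq0. Qed.

Lemma cnum_neq0 s : D.[s] = 0 -> N.[s] != 0.
Proof.
have /coprimep_root h : coprimep D N by rewrite coprimep_map coprimep_sym rf_coprime.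
by move=> /eqP; exact: h.
Qed.

Lemma is_poleE s : is_pole G s <-> D.[s] = 0.
Proof.
rewrite /is_pole /pole_order -/D -XsubC_dvd ?cden_neq0// dvdp_XsubCl.
by split=> [/eqP|/eqP].
Qed.

Lemma mx_pole_order1 s : mx_pole_order (const_mx G : 'M[{fraction {poly R}}]_1) s = pole_order G s.
Proof. by rewrite /mx_pole_order !big_ord1 mxE. Qed.

Lemma mx_eval1 s : mx_eval (const_mx G : 'M[{fraction {poly R}}]_1) s 0 0 = rf_eval G s.
Proof. by rewrite !mxE. Qed.

(** The scalar form of the definition, freed from matrices of size 1 and stated
    with the denominator of [G] in lowest terms. *)
Lemma negative_imaginary1P :
  negative_imaginary (const_mx G : 'M[{fraction {poly R}}]_1) <->
  [/\ forall s, 0 < Re s -> D.[s] != 0,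
      forall y : R, 0 <= y -> D.[(0 +i* y)%C] != 0 -> Im (rf_eval G (0 +i* y)%C) <= 0,
      forall y : R, 0 < y -> D.[(0 +i* y)%C] = 0 ->
        pole_order G (0 +i* y)%C = 1%N /\
        exists2 K : C, limc (fun s => (s - (0 +i* y)%C) * ('i%R * rf_eval G s)) (0 +i* y)%C K
                     & 0 <= K &
      D.[0] = 0 ->
        (pole_order G 0 = 1%N \/ pole_order G 0 = 2%N) /\
        (pole_order G 0 = 2%N ->
         exists2 L : C, limc (fun s => s ^+ 2 * rf_eval G s) 0 L & 0 <= L)].
Proof.
have poleE s : is_mx_pole (const_mx G : 'M[{fraction {poly R}}]_1) s <-> D.[s] = 0.
  by rewrite /is_mx_pole mx_pole_order1; exact: is_poleE.
have npoleE s : ~ is_mx_pole (const_mx G : 'M[{fraction {poly R}}]_1) s <-> D.[s] != 0.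
  by split=> [h|/eqP h]; [apply/eqP => /poleE|move=> /poleE].
split=> [[h1 h2 h3 h4]|[h1 h2 h3 h4]]; split.
- by move=> s /h1/npoleE.
- move=> y y0 /npoleE /(h2 y y0) /psd1.
  by rewrite 2!mxE mx_eval1 !mxE ge0_i_subJ.
- move=> y y0 /poleE /(h3 y y0) [+ [K /mx1_cvgP hK /psd1 K0]].
  rewrite mx_pole_order1 => ->; split=> //; exists (K 0 0) => //.
  by move: hK; under [X in limc X]eq_fun do rewrite !mxE.
- move=> /poleE /h4; rewrite mx_pole_order1 => -[h h']; split=> // /h' [L /mx1_cvgP hL /psd1 L0].
  exists (L 0 0) => //.
  by move: hL; under [X in limc X]eq_fun do rewrite !mxE.
- by move=> s /h1/npoleE.
- move=> y y0 /npoleE /(h2 y y0) h; apply/psd1.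
  by rewrite 2!mxE mx_eval1 !mxE ge0_i_subJ.
- move=> y y0 /poleE /(h3 y y0) [+ [K hK K0]].
  rewrite mx_pole_order1 => ->; split=> //; exists (const_mx K); last by apply/psd1; rewrite mxE.
  apply/mx1_cvgP; rewrite mxE; move: hK.
  by under [X in _ -> limc X _ _]eq_fun do rewrite !mxE.
- move=> /poleE /h4; rewrite mx_pole_order1 => -[h h']; split=> // /h' [L hL L0].
  exists (const_mx L); last by apply/psd1; rewrite mxE.
  apply/mx1_cvgP; rewrite mxE; move: hL.
  by under [X in _ -> limc X _ _]eq_fun do rewrite !mxE.
Qed.

Lemma complex_poly_divide_out (n e q : {poly R}) (c : R) z :
  n = c%:P * e + ('X - 0%:P) * q ->
  (complex_poly n).[z] = c%:C%C * (complex_poly e).[z] + z * (complex_poly q).[z].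
Proof.
move=> ->; rewrite /complex_poly rmorphD !rmorphM rmorphB /= map_polyX !map_polyC /=.
by rewrite subr0 hornerD hornerM hornerC hornerM hornerX.
Qed.

(** The cofactor at the origin is taken among real polynomials, so that the
    coefficients of the polar part of [G] at the origin are real. *)
Lemma rf_den_origin : exists e : {poly R},
  [/\ rf_den G = ('X - 0%:P) ^+ pole_order G 0 * e, e.[0] != 0,
      (complex_poly e).[0] != 0 &
      forall z, D.[z] = z ^+ pole_order G 0 * (complex_poly e).[z]].
Proof.
have [e eE e0] := mup_cofactor 0 (rf_den_neq0 G).
have e0' : (complex_poly e).[0] != 0.
  by rewrite -[X in _.[X]](rmorph0 (real_complex R)) horner_map fmorph_eq0.
have DE : D = ('X - 0%:P) ^+ mup 0 (rf_den G) * complex_poly e.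
  by rewrite /D {1}eE /complex_poly rmorphM rmorphXn rmorphB /= map_polyX map_polyC.
have mE : pole_order G 0 = mup 0 (rf_den G).
  by rewrite /pole_order -/D DE mupMl// mup_XsubCX eqxx.
exists e; rewrite mE; split=> // z.
by rewrite DE hornerM horner_exp hornerXsubC subr0.
Qed.

(** The hypotheses of [quadrant_le0] at the poles come from the residue and the
    double pole conditions: the limits in the definition are identified with the
    leading coefficients of [G]. *)
Lemma negative_imaginary_quadrant (hG : rf_proper G) :
  negative_imaginary (const_mx G : 'M[{fraction {poly R}}]_1) ->
  forall z, 0 <= Re z -> 0 <= Im z -> D.[z] != 0 -> Im (rf_eval G z) <= 0.
Proof.
move=> /negative_imaginary1P [h1 h2 h3 h4] z rz iz Dz.
apply: (quadrant_le0 (rf_den_neq0 G) hG h1 h2) => // y y0 Dy eta eta0.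
have [y00|yp] := eqVneq y 0; last first.
  have {yp}y0 : 0 < y by rewrite lt_neqAle eq_sym yp.
  have [m1 [K hK K0]] := h3 y y0 Dy.
  set w := (0 +i* y)%C in Dy m1 hK *.
  have [E DE Ew] := mup_cofactor w cden_neq0.
  rewrite -[mup w D]/(pole_order G w) m1 expr1 in DE.
  have KE : K = 'i%C * (N.[w] / E.[w]).
    apply: (limc_unique hK).
    have -> : 'i%C * (N.[w] / E.[w]) = ('i%C *: N).[w] / E.[w] by rewrite hornerZ mulrA.
    apply: limc_removable => // s sw Es.
    have sw0 : s - w != 0 by rewrite subr_eq0.
    rewrite /rf_eval -/N -/D DE hornerM hornerXsubC hornerZ -complexiE.
    by field; rewrite sw0 Es.
  have NK : N.[w] / E.[w] = (0 -i* Re K)%C.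
    have -> : N.[w] / E.[w] = - 'i%C * K by rewrite KE mulrA mulNr -expr2 sqr_i opprK mul1r.
    rewrite -[K in LHS]RRe_real ?ger0_real//; simpc; by [].
  have K0' : 0 <= Re K by rewrite -ler0c RRe_real// ger0_real.
  rewrite -/D DE.
  have [|d d0 hd] := imaginary_pole_lt Ew y0 K0' NK _ eta0.
    by move=> t t0; rewrite -DE; exact: h2.
  by exists d => // s s0 _ Ds sd; exact: hd.
(* The pole is at the origin, of order 1 or 2. *)
rewrite y00 in Dy *.
have [m12 hm2] := h4 Dy.
have [e [eE e0 ce0 DzE]] := rf_den_origin.
have [q1 q1E] := divide_out_root (rf_num G) e0.
set r := (rf_num G).[0] / e.[0] in q1E.
have N1 s := complex_poly_divide_out s q1E.
have GE : exists a b : R, exists q : {poly R}, 0 <= a /\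
  forall s, s != 0 -> (complex_poly e).[s] != 0 ->
    rf_eval G s = a%:C%C * s^-1 ^+ 2 + b%:C%C * s^-1 + (complex_poly q).[s] / (complex_poly e).[s].
  case: m12 => m.
    exists 0, r, q1; split=> // s s0 es.
    rewrite /rf_eval -/D DzE m N1 mul0r add0r expr1.
    by field; rewrite s0 es.
  have [L hL L0] := hm2 m.
  have [q2] := divide_out_root q1 e0; move: (q1.[0] / e.[0]) => b q2E.
  exists r, b, q2; split.
    suff LE : L = r%:C%C by rewrite -ler0c -LE.
    apply: (limc_unique hL).
    have -> : r%:C%C = N.[0] / (complex_poly e).[0].
      by rewrite N1 mul0r addr0 mulfK.
    apply: limc_removable => // s s0 es.
    by rewrite /rf_eval -/N -/D DzE m; field; rewrite s0 es.
  move=> s s0 es.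
  rewrite /rf_eval -/D DzE m N1 (complex_poly_divide_out s q2E).
  by field; rewrite s0 es.
have [a [b [q [a0 {}GE]]]] := GE.
have [||d d0 hd] := origin_pole_lt ce0 a0 _ GE _ eta0.
- by rewrite -(rmorph0 (real_complex R)) Im_real_ratio.
- move=> t t0 et; apply: h2; rewrite ?ltW//.
  by rewrite DzE mulf_neq0// expf_neq0// imag_neq0.
exists d => // s rs is_ Ds; rewrite subr0 => sd.
have mpos : (0 < pole_order G 0%R)%N by case: m12 => ->.
have /andP[s0 es] : (s != 0) && ((complex_poly e).[s] != 0).
  have : D.[s] != 0 by []; by rewrite DzE mulf_eq0 negb_or expf_eq0 mpos.
exact: hd.
Qed.

(** Every pole on the axis is tested along rays that stay in the quadrant: the
    directions of the right half plane at [j y] with [y > 0], those of the first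
    quadrant at the origin. *)
Lemma quadrant_negative_imaginary :
  (forall s, 0 < Re s -> D.[s] != 0) ->
  (forall z, 0 <= Re z -> 0 <= Im z -> Im (rf_eval G z) <= 0) ->
  negative_imaginary (const_mx G : 'M[{fraction {poly R}}]_1).
Proof.
move=> h1 h2; apply/negative_imaginary1P; split=> //.
- by move=> y y0 _; apply: h2.
- move=> y y0 Dy; set w := (0 +i* y)%C in Dy *.
  have [E DE Ew] := mup_cofactor w cden_neq0.
  rewrite -[mup w D]/(pole_order G w) in DE; set m := pole_order G w in DE *.
  have m0 : (0 < m)%N by apply/is_poleE.
  set u := N.[w] / E.[w].
  have u0 : u != 0 by rewrite mulf_neq0 ?invr_eq0// cnum_neq0.
  (* [cis (- x)] points into the right half plane; [t < y] keeps [Im] positive. *)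
  have ray x : - (pi / 2) <= x <= pi / 2 -> Im (u * cis (m%:R * x)) <= 0.
    move=> x2; rewrite -cisX -[x]opprK -cisV.
    apply: Im_polar_ray => //; exists y => // t t0 ty.
    rewrite -DE; apply: h2; rewrite /w /cis; simpc; rewrite /=.
      by rewrite cosN mulr_ge0 ?(ltW t0)// cos_ge0_pihalf.
    have := sin_geN1 (- x); nra.
  have [Ru um] := cis_sector_le0 m0 ray.
  have m1 : m = 1%N.
    by apply/eqP; rewrite eqn_leq m0 andbT leqNgt; apply/negP => /um/eqP; apply/negP.
  have Iu : Im u <= 0.
    have := ray 0; rewrite mulr0 /cis cos0 sin0 mulr1; apply.
    by rewrite oppr_le0 divr_ge0 ?pi_ge0.
  split=> //; exists ('i%C * u); last first.
    by case: (u) Ru Iu => a b /= -> b0; simpc; rewrite /= ?eqxx ?oppr_ge0.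
  have -> : 'i%C * u = ('i%C *: N).[w] / E.[w] by rewrite hornerZ mulrA.
  apply: limc_removable => // s sw Es.
  have sw0 : s - w != 0 by rewrite subr_eq0.
  rewrite /rf_eval -/N -/D DE m1 expr1 hornerM hornerXsubC hornerZ -complexiE.
  by field; rewrite sw0 Es.
move=> D0.
have [e [eE e0 ce0 DzE]] := rf_den_origin.
have m0 : (0 < pole_order G 0%R)%N by apply/is_poleE.
set m := pole_order G 0 in eE DzE m0 *.
set r := (rf_num G).[0] / e.[0].
have rE : N.[0] / (complex_poly e).[0] = r%:C%C.
  rewrite -[X in N.[X]](rmorph0 (real_complex R)) -[X in (complex_poly e).[X]](rmorph0 (real_complex R)).
  by rewrite !horner_map -fmorph_div.
have r0 : r != 0.
  rewrite -(fmorph_eq0 (real_complex R)) /= -rE.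
  by rewrite mulf_neq0 ?invr_eq0// cnum_neq0.
have DE : D = ('X - 0%:P) ^+ m * complex_poly e.
  by rewrite /D eE /complex_poly rmorphM rmorphXn rmorphB /= map_polyX map_polyC.
(* The direction [cis x] points into the first quadrant. *)
have ray x : 0 <= x <= pi / 2 -> 0 <= r * sin (m%:R * x).
  move=> /andP[x0 x2].
  have : Im (N.[0] / (complex_poly e).[0] * (cis x)^-1 ^+ m) <= 0.
    apply: Im_polar_ray => //; exists 1 => // t t0 _.
    rewrite -DE; apply: h2; rewrite add0r /cis; simpc; rewrite /=.
      rewrite mulr_ge0 ?(ltW t0)// cos_ge0_pihalf// x2 andbT (le_trans _ x0)//.
      by rewrite oppr_le0 divr_ge0 ?pi_ge0.
    rewrite mulr_ge0 ?(ltW t0)// sin_ge0_pi// x0 (le_trans x2)//.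
    by rewrite ler_pdivrMr// ler_peMr ?pi_ge0// ler1n.
  by rewrite rE cisV cisX ImZ /= mulrN sinN mulrN oppr_le0.
have p2 : 0 < pi / 2 :> R by rewrite divr_gt0// pi_gt0.
have mR : (m%:R : R) != 0 by rewrite pnatr_eq0 -lt0n.
have rp : 0 < r.
  rewrite lt_neqAle eq_sym r0 /=.
  (* The sine is [1] at the direction [x] with [m x = pi / 2]. *)
  have := ray (pi / 2 / m%:R); rewrite mulrCA mulfV// mulr1 sin_pihalf mulr1; apply.
  rewrite (divr_ge0 (ltW p2)) ?ler0n//= ler_pdivrMr ?ltr0n// ler_peMr ?ler1n//.
  exact: ltW.
have m2 : (m <= 2)%N.
  rewrite leqNgt; apply/negP => m3.
  (* For [m >= 3] the direction with [m x = 3 pi / 2], of sine [-1], is admissible. *)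
  have := ray (3 * (pi / 2) / m%:R).
  have -> : m%:R * (3 * (pi / 2) / m%:R) = pi / 2 + pi :> R by field.
  rewrite sinDpi sin_pihalf mulrN1 oppr_ge0 [r <= 0]leNgt rp => h.
  suff : false by [].
  apply: h; rewrite divr_ge0 ?ler0n ?mulr_ge0 ?invr_ge0 ?pi_ge0//=.
  rewrite ler_pdivrMr ?ltr0n//.
  have : (3 : R) <= m%:R by rewrite ler_nat.
  by have := pi_gt0 R; nra.
split; first by case: (m) m0 m2 => [|[|[|]]]// _ _; [left|right].
move=> mE; exists r%:C%C; last by rewrite ler0c ltW.
rewrite -rE; apply: limc_removable => // s s0 es.
by rewrite /rf_eval -/N -/D DzE mE; field; rewrite s0 es.
Qed.

(** At a pole [s] the product of [G] and its denominator would be continuous,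
    with value [0] at [s], whereas it agrees with the numerator around [s], which
    does not vanish at [s]. *)
Lemma analytic_rhpP :
  analytic_on [set s | 0 < Re s] (rf_eval G) <-> forall s, 0 < Re s -> D.[s] != 0.
Proof.
split=> [h s s0|h s /= s0].
  apply/eqP => Ds.
  have [E DE Es] := mup_cofactor s cden_neq0.
  have : derivable ((fun z => rf_eval G z * D.[z]) : C^o -> C^o) s 1.
    apply: derivableM; first exact: nbhs_singleton (h s s0).
    exact: derivable_horner_num.
  move=> /derivable1_diffP/differentiable_continuous/cvgrPdist_lt hc.
  have l0 : limc (fun z => rf_eval G z * D.[z]) s 0.
    move=> e e0.
    have eC : 0 < e%:C%C :> C by rewrite ltcR.
    have : nbhs (s : C^o) (fun z => normc (rf_eval G z * D.[z] - 0) < e).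
      apply: filterS (hc _ eC) => z.
      by rewrite Ds mulr0 distrC normcE_norm ltcR.
    move=> /nbhs_normcP[d d0 hd]; exists d => // z _; exact: hd.
  have l1 : limc (fun z => rf_eval G z * D.[z]) s N.[s].
    have -> : N.[s] = (N * E).[s] / E.[s] by rewrite hornerM mulfK.
    apply: limc_removable => // z zs Ez.
    rewrite hornerM mulfK// /rf_eval divfK// -/D DE hornerM horner_exp hornerXsubC.
    by rewrite mulf_neq0// expf_neq0// subr_eq0.
  by have := cnum_neq0 Ds; rewrite -(limc_unique l0 l1) eqxx.
have [d d0 hd] := horner_near_neq0 (h s s0).
apply/nbhs_normcP; exists d => // z zd.
by apply: derivable_ratio; exact: hd.
Qed.

End Scalar.
End ComplexPlane.

Unset Implicit Arguments.
Set Strict Implicit.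

(** * The equivalence *)

Theorem mainTheorem1 (R : realType) (G : {fraction {poly R}}) (hG : rf_proper G) :
  negative_imaginary (const_mx G : 'M[{fraction {poly R}}]_1) <->
  analytic_on [set s | 0 < complex.Re s] (rf_eval G) /\
  forall w eps : R, 0 <= w -> 0 <= eps -> ~ is_pole G (eps +i* w)%C ->
    0 <= 'i * (rf_eval G (eps +i* w)%C - (rf_eval G (eps +i* w)%C)^*).
Proof.
split=> [ni|[an ineq]].
  split; first by have /negative_imaginary1P[h1 _ _ _] := ni; apply/analytic_rhpP.
  move=> w eps w0 eps0 np; rewrite ge0_i_subJ; apply: negative_imaginary_quadrant => //.
  by apply/eqP => /is_poleE.
apply: quadrant_negative_imaginary; first exact/analytic_rhpP.
move=> [eps w] /= eps0 w0.
have [D0|/eqP D0] := eqVneq (complex_poly (rf_den G)).[(eps +i* w)%C] 0.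
  (* At a pole the value of [rf_eval] is [0]. *)
  by rewrite /rf_eval D0 invr0 mulr0.
by rewrite -ge0_i_subJ; apply: ineq => // /is_poleE.
Qed.
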